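(* Let $\mathcal{A}=\{A_1,\ldots,A_M\}\subset\mathbb{R}^{n\times n}$ be a set of $M$ matrices and let $\mathcal{G}=(S,E)$ be a Path-Complete graph on $M$ labels. If there is a Path-Complete Lyapunov function $V\sim\mathrm{pclf}(\mathcal{G},\mathcal{A})$, then a common Lyapunov function for the switching system $x(t+1)=A_{\sigma(t)}x(t)$, $\sigma(t)\in\{1,\ldots,M\}$, is given by $$V^*(x)=\min_{Q\in S^{obs}}\Big(\max_{s\in Q}V_s(x)\Big),$$ where $S^{obs}$ is the set of nodes of the observer graph $\mathcal{G}^{obs}=(S^{obs},E^{obs})$ of $\mathcal{G}$.
   Context: Write $\langle M\rangle=\{1,\ldots,M\}$. A graph $\mathcal{G}=(S,E)$ on $M$ labels (modes) is a directed labeled graph with finite nonempty node set $S$ and edge set $E\subseteq S\times S\times\langle M\rangle$; an edge $(s,d,\sigma)$ goes from $s$ to $d$ and has label $\sigma$. Path-Complete: $\mathcal{G}$ is Path-Complete if for every $k\ge1$ and every sequence $\sigma_1,\ldots,\sigma_k$ with $\sigma_i\in\langle M\rangle$ there are nodes $s_1,\ldots,s_{k+1}\in S$ with $(s_i,s_{i+1},\sigma_i)\in E$ for $i=1,\ldots,k$. VLFC: a Vector Lyapunov Function Candidate is a function $V:\mathbb{R}^n\to\mathbb{R}^N_{\ge0}$ each of whose components $V_i$ is a positive definite quadratic function, i.e. $V_i(x)=x^\top Q_i x$ with $Q_i\succ0$ symmetric. When $N=|S|$, the components are indexed by the nodes, and $V_s$ denotes the component of node $s\in S$. PCLF: for a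 Path-Complete graph $\mathcal{G}=(S,E)$ on $M$ labels and $\mathcal{A}=\{A_1,\ldots,A_M\}\subset\mathbb{R}^{n\times n}$, $V\sim\mathrm{pclf}(\mathcal{G},\mathcal{A})$ (''$V$ is a Path-Complete Lyapunov function for $\mathcal{G}$ and $\mathcal{A}$'') means that $V:\mathbb{R}^n\to\mathbb{R}^{|S|}_{\ge0}$ is a VLFC such that $V_d(A_\sigma x)\le V_s(x)$ for all $x\in\mathbb{R}^n$ and all $(s,d,\sigma)\in E$. Common Lyapunov function: a positive definite function $W:\mathbb{R}^n\to\mathbb{R}_{\ge0}$ ($W(0)=0$, $W(x)>0$ for $x\neq0$) such that $W(A_\sigma x)\le W(x)$ for all $\sigma\in\langle M\rangle$ and all $x\in\mathbb{R}^n$. Observer graph: the observer graph $\mathcal{G}^{obs}=(S^{obs},E^{obs})$ of $\mathcal{G}=(S,E)$ has nodes that are subsets of $S$ ($S^{obs}\subseteq 2^S$) and is constructed as follows. (1) Initialize $S^{obs}:=\{S\}$ and $E^{obs}:=\emptyset$. (2) Let $X:=\emptyset$. For each pair $(P,\sigma)\in S^{obs}\times\langle M\rangle$: (i) compute $Q:=\bigcup_{p\in P}\{q\mid (p,q,\sigma)\in E\}$; (ii) if $Q\neq\emptyset$, set $E^{obs}:=E^{obs}\cup\{(P,Q,\sigma)\}$ and $X:=X\cup\{Q\}$. (3) If $X\subseteq S^{obs}$, the observer graph is $(S^{obs},E^{obs})$; otherwise set $S^{obs}:=S^{obs}\cup X$ and return to step (2). *)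

(* Defs.v *)
From HB Require Import structures.
From mathcomp Require Import all_boot all_order all_algebra.
From mathcomp Require Import reals.

Set Implicit Arguments.
Unset Strict Implicit.
Unset Printing Implicit Defensive.

Import Order.TTheory GRing.Theory Num.Theory.
Local Open Scope ring_scope.

(* Labels 1, ..., M are represented by 'I_M (0-based). *)
Record lgraph (M : nat) := LGraph {
  node : finType;
  node_gt0 : (0 < #|node|)%N;
  edge : {set node * node * 'I_M}
}.

Definition path_complete (M : nat) (G : lgraph M) : Prop :=
  forall (k : nat) (sigma : 'I_k -> 'I_M), (0 < k)%N ->
  exists s : 'I_k.+1 -> node G, forall i : 'I_k,
    (s (widen_ord (leqnSn k) i), s (lift ord0 i), sigma i) \in edge G.

Section Lyapunov.
Variables (R : realType) (n : nat).
Implicit Types (Q : 'M[R]_n) (x : 'cV[R]_n).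

Definition quadform Q x : R := (x^T *m Q *m x) 0 0.

Definition posdefmx Q : Prop :=
  Q^T = Q /\ (forall x, x != 0 -> 0 < quadform Q x).

(* The components are indexed by an arbitrary finite type [I] in place of
   {1, ..., N}. *)
Definition vlfc (I : finType) (V : 'cV[R]_n -> I -> R) : Prop :=
  (forall x i, 0 <= V x i) /\
  (forall i, exists2 Q : 'M[R]_n, posdefmx Q & forall x, V x i = quadform Q x).

Definition pclf (M : nat) (G : lgraph M) (A : 'I_M -> 'M[R]_n)
    (V : 'cV[R]_n -> node G -> R) : Prop :=
  vlfc V /\
  (forall (x : 'cV[R]_n) (s d : node G) (sigma : 'I_M),
     (s, d, sigma) \in edge G -> V (A sigma *m x) d <= V x s).

Definition posdef_fun (W : 'cV[R]_n -> R) : Prop :=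
  [/\ forall x, 0 <= W x, W 0 = 0 & forall x, x != 0 -> 0 < W x].

Definition common_lyapunov (M : nat) (A : 'I_M -> 'M[R]_n)
    (W : 'cV[R]_n -> R) : Prop :=
  posdef_fun W /\ (forall (sigma : 'I_M) x, W (A sigma *m x) <= W x).

End Lyapunov.

Section Observer.
Variables (M : nat) (G : lgraph M).
Local Notation S := (node G).
Implicit Types (P : {set S}) (So : {set {set S}})
  (Eo : {set {set S} * {set S} * 'I_M}).

Definition obs_succ P (sigma : 'I_M) : {set S} :=
  \bigcup_(p in P) [set q | (p, q, sigma) \in edge G].

Definition obs_new_edges So : {set {set S} * {set S} * 'I_M} :=
  [set (P, obs_succ P sigma, sigma)
    | P in So, sigma in [set: 'I_M] & obs_succ P sigma != set0].

Definition obs_new_nodes So : {set {set S}} :=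
  [set obs_succ P sigma
    | P in So, sigma in [set: 'I_M] & obs_succ P sigma != set0].

(* [fuel] bounds the number of passes; by [obs_loop_fuel] below, the bound
   chosen in [observer] is never reached before the stopping test succeeds. *)
Fixpoint obs_loop (fuel : nat) So Eo :=
  if fuel is k.+1 then
    let X := obs_new_nodes So in
    let Eo' := Eo :|: obs_new_edges So in
    if X \subset So then (So, Eo') else obs_loop k (So :|: X) Eo'
  else (So, Eo).

Definition observer := obs_loop #|{set S}| [set [set: S]] set0.
Definition obs_nodes : {set {set S}} := observer.1.
Definition obs_edges : {set {set S} * {set S} * 'I_M} := observer.2.

Lemma obs_loop_fuel k l So Eo :
  (#|~: So| < k)%N -> (k <= l)%N -> obs_loop k So Eo = obs_loop l So Eo.
Proof.
elim: k l So Eo => [|k IHk] [|l] So Eo //= ltk lekl.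
case: ifPn => // XnS; apply: IHk => //.
apply: leq_trans (_ : (#|~: So| <= k)%N) => //.
apply: proper_card; rewrite properC properE subsetUl subUset subxx /=.
exact: XnS.
Qed.

Lemma observer_fuel k : (#|{set S}| <= k)%N ->
  observer = obs_loop k [set [set: S]] set0.
Proof.
move=> lek; apply: obs_loop_fuel => //.
by rewrite cardsCs setCK cards1 ltn_subrL /=; apply/card_gt0P; exists set0.
Qed.

Lemma obs_new_nodes_neq0 So : set0 \notin obs_new_nodes So.
Proof.
by apply/negP => /imset2P[P s _]; rewrite inE => /andP[_ /negP h] e; apply: h;
  rewrite -e.
Qed.

Lemma obs_loop_sub k So Eo : So \subset (obs_loop k So Eo).1.
Proof.
elim: k So Eo => [|k IHk] So Eo //=; case: ifP => // _.
by apply: subset_trans (IHk _ _); apply: subsetUl.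
Qed.

Lemma setT_obs_nodes : [set: S] \in obs_nodes.
Proof.
have /subsetP := obs_loop_sub #|{set S}| [set setT] set0.
by apply; rewrite inE.
Qed.

Lemma set0_obs_nodes : set0 \notin obs_nodes.
Proof.
have: set0 \notin [set [set: S]].
  rewrite inE eq_sym -cards_eq0 cardsT -lt0n; exact: node_gt0.
rewrite /obs_nodes /observer.
elim: #|{set S}| [set [set: S]] (set0 : {set {set S} * {set S} * 'I_M})
  => [|k IHk] So Eo //= S0.
case: ifP => // _; apply: IHk.
by rewrite inE negb_or S0 obs_new_nodes_neq0.
Qed.

Lemma obs_nodes_closed P sigma :
  P \in obs_nodes -> obs_succ P sigma != set0 -> obs_succ P sigma \in obs_nodes.
Proof.
move=> PS s0; suff /subsetP : obs_new_nodes obs_nodes \subset obs_nodes.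
  by apply; apply/imset2P; exists P sigma => //; rewrite !inE.
have: (#|~: [set [set: S]]| < #|{set S}|)%N.
  by rewrite cardsCs setCK cards1 ltn_subrL /=; apply/card_gt0P; exists set0.
rewrite /obs_nodes /observer.
elim: #|{set S}| [set [set: S]] (set0 : {set {set S} * {set S} * 'I_M})
  => [|k IHk] So Eo //= ltk.
case: ifPn => // XnS; apply: IHk.
apply: leq_trans (_ : (#|~: So| <= k)%N) => //.
apply: proper_card; rewrite properC properE subsetUl subUset subxx /=.
exact: XnS.
Qed.

Section Vstar.
Variables (R : realType) (n : nat) (V : 'cV[R]_n -> node G -> R).

(* The default value 0 is harmless since the components of a VLFC are
   nonnegative and no observer node is empty: see [maxV_max] and
   [set0_obs_nodes]. *)
Definition maxV (Q : {set S}) (x : 'cV[R]_n) : R :=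
  \big[Num.max/0]_(s in Q) V x s.

(* The default value is the term of the observer node Q = S, so it does not
   change the minimum: see [Vstar_min]. *)
Definition Vstar (x : 'cV[R]_n) : R :=
  \big[Num.min/maxV [set: S] x]_(Q in obs_nodes) maxV Q x.

Lemma maxV_max Q x : (forall s, 0 <= V x s) -> Q != set0 ->
  (exists2 s, s \in Q & maxV Q x = V x s) /\
  (forall s, s \in Q -> V x s <= maxV Q x).
Proof.
move=> V0 /set0Pn[s0 s0Q]; split=> [|s sQ]; last exact: (le_bigmax_cond 0 (V x) sQ).
have [s sQ le_s] := arg_maxP (V x) s0Q.
exists s => //; apply/le_anti/andP; split; first exact: bigmax_le.
exact: (le_bigmax_cond 0 (V x) sQ).
Qed.

Lemma Vstar_min x :
  (exists2 Q, Q \in obs_nodes & Vstar x = maxV Q x) /\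
  (forall Q, Q \in obs_nodes -> Vstar x <= maxV Q x).
Proof.
split=> [|Q QS]; last exact: bigmin_le_cond QS.
rewrite /Vstar; apply: (big_ind (fun u => exists2 Q, Q \in obs_nodes & u = maxV Q x))
  => [|u v [P PS ->] [Q QS ->]|Q QS].
- by exists [set: S] => //; exact: setT_obs_nodes.
- by rewrite /Num.min; case: ifP => _; [exists P | exists Q].
- by exists Q.
Qed.

End Vstar.
End Observer.

(* Main.v *)
Require Import Defs.
From mathcomp Require Import all_boot all_order all_algebra.
From mathcomp Require Import reals.

(** Every observer node is the set of endpoints of all paths of [G] carrying
    some word [w].  Path-completeness, applied to [w] followed by a label
    [sigma], makes the [sigma]-successor of that node nonempty, so the observer
    graph has an outgoing edge for every node and every label.  If the node [P]
    attains the minimum in [Vstar V x], then the inequalities along the edges of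
    [G] show that the [sigma]-successor of [P] yields a value at [A sigma *m x]
    that is no larger. *)

Import Order.TTheory GRing.Theory Num.Theory.
Local Open Scope ring_scope.

Section ObserverWords.
Variables (M : nat) (G : lgraph M).

Lemma obs_succP (P : {set node G}) (sigma : 'I_M) (d : node G) :
  reflect (exists2 p, p \in P & (p, d, sigma) \in edge G)
          (d \in obs_succ P sigma).
Proof.
by apply: (iffP bigcupP) => -[p pP]; rewrite ?inE => pd; exists p; rewrite ?inE.
Qed.

Definition endpoints (w : seq 'I_M) : {set node G} :=
  foldl (@obs_succ M G) [set: node G] w.

Lemma endpoints_rcons w sigma :
  endpoints (rcons w sigma) = obs_succ (endpoints w) sigma.
Proof. exact: foldl_rcons. Qed.

(** Induction along the path: the claim covers every prefix of [w] because each step extends the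
    previous prefix by one edge. *)
Lemma endpoints_path k (w : k.-tuple 'I_M) (s : 'I_k.+1 -> node G) :
    (forall i : 'I_k,
      (s (widen_ord (leqnSn k) i), s (lift ord0 i), tnth w i) \in edge G) ->
  forall i : 'I_k.+1, s i \in endpoints (take i w).
Proof.
move=> sE [i]; elim: i => [|i IHi] lti; first by rewrite take0 inE.
have ltik : (i < k)%N by [].
have x0 : 'I_M := tnth w (Ordinal ltik).
rewrite (take_nth x0) ?size_tuple // endpoints_rcons; apply/obs_succP.
exists (s (widen_ord (leqnSn k) (Ordinal ltik))).
  have -> : widen_ord (leqnSn k) (Ordinal ltik) = Ordinal (ltnW lti).
    exact: val_inj.
  exact: IHi.
have -> : Ordinal lti = lift ord0 (Ordinal ltik) by exact: val_inj.
by have := sE (Ordinal ltik); rewrite (tnth_nth x0).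
Qed.

Lemma endpoints_neq0 (w : seq 'I_M) :
  path_complete G -> (0 < size w)%N -> endpoints w != set0.
Proof.
move=> hG w0; have [s sE] := hG _ (tnth (in_tuple w)) w0.
apply/set0Pn; exists (s ord_max).
by have := @endpoints_path _ (in_tuple w) s sE ord_max; rewrite take_size.
Qed.

Lemma obs_nodes_endpoints P : P \in obs_nodes G -> exists w, P = endpoints w.
Proof.
rewrite /obs_nodes /observer.
(* Loop invariant, kept for arbitrary fuel: each new node appends one label to the word of an old
   node. *)
have: forall P, P \in [set [set: node G]] -> exists w, P = endpoints w.
  by move=> _ /set1P ->; exists [::].
elim: #|{set node G}| [set _] (set0 : {set {set _} * {set _} * 'I_M})
  => [|k IHk] So Eo SoP /=; first exact: SoP.
case: ifP => _; first exact: SoP.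
apply: IHk => Q; rewrite inE => /orP[/SoP //|/imset2P[T sigma]].
move=> /SoP[w ->] _ ->.
by exists (rcons w sigma); rewrite endpoints_rcons.
Qed.

(** Appending [sigma] makes the word nonempty, so path-completeness applies even to the initial
    node, whose word is empty. *)
Lemma obs_succ_neq0 P sigma :
  path_complete G -> P \in obs_nodes G -> obs_succ P sigma != set0.
Proof.
move=> hG /obs_nodes_endpoints[w ->]; rewrite -endpoints_rcons.
by apply: endpoints_neq0; rewrite ?size_rcons.
Qed.

End ObserverWords.

Lemma obs_nodes_neq0 (M : nat) (G : lgraph M) P : P \in obs_nodes G -> P != set0.
Proof. by apply: contraTneq => ->; exact: set0_obs_nodes. Qed.

Section VlfcMinMax.
Variables (R : realType) (n M : nat) (G : lgraph M).
Variable V : 'cV[R]_n -> node G -> R.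
Hypothesis hV : vlfc V.

Lemma vlfc_at0 s : V 0 s = 0.
Proof. by have [Q _ ->] := hV.2 s; rewrite /quadform mulmx0 mxE. Qed.

Lemma vlfc_gt0 x s : x != 0 -> 0 < V x s.
Proof. by move=> x0; have [Q [_ Qpos] ->] := hV.2 s; exact: Qpos. Qed.

(** The minimum and the maximum are both attained, so positive definiteness passes from the
    components to [Vstar V] pointwise. *)
Lemma Vstar_attained x : exists s, Vstar V x = V x s.
Proof.
have [[Q QS ->] _] := Vstar_min V x.
by have [[s _ ->] _] := maxV_max (hV.1 x) (obs_nodes_neq0 _ _ _ QS); exists s.
Qed.

Lemma Vstar_posdef : posdef_fun (Vstar V).
Proof.
split=> [x||x x0].
- by have [s ->] := Vstar_attained x; exact: hV.1.
- by have [s ->] := Vstar_attained 0; exact: vlfc_at0.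
- by have [s ->] := Vstar_attained x; exact: vlfc_gt0.
Qed.

End VlfcMinMax.

Theorem mainTheorem1 (R : realType) (n M : nat) (A : 'I_M -> 'M[R]_n)
    (G : lgraph M) (hG : path_complete G)
    (V : 'cV[R]_n -> node G -> R) (hV : pclf A V) :
  common_lyapunov A (Vstar V).
Proof.
have [hvlfc hdec] := hV; split; first exact: Vstar_posdef.
move=> sigma x; have [[P PS ->] _] := Vstar_min V x.
have Q0 : obs_succ P sigma != set0 by exact: obs_succ_neq0.
have [_ Vmin] := Vstar_min V (A sigma *m x).
apply: le_trans (Vmin _ (obs_nodes_closed PS Q0)) _.
(* [d] attains the maximum over the successor of [P], and [p] is a predecessor of [d] in [P]. *)
have [[d /obs_succP[p pP pd] ->] _] := maxV_max (hvlfc.1 (A sigma *m x)) Q0.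
have [_ Pmax] := maxV_max (hvlfc.1 x) (obs_nodes_neq0 _ _ _ PS).
exact: le_trans (hdec _ _ _ _ pd) (Pmax _ pP).
Qed.
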